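(* (Discrete Korn inequality.) Suppose that $\mathcal R\subset\mathcal G$ has Property 2. Then the seminorms $\|\cdot\|_{\mathcal R}$ and $\|\cdot\|_{\mathcal R,0}$ on $U_{\mathrm{per}}$ are equivalent.
   Context: Euclidean group: $\mathrm E(n)$ consists of pairs $(A|b)$, $A\in\mathrm O(n)$, $b\in\mathbb R^n$, acting by $(A|b)\cdot x=Ax+b$, product $(A_1|b_1)(A_2|b_2)=(A_1A_2|b_1+A_1b_2)$; $\mathrm{rot}(A|b)=A$. Standing setting: $d=d_1+d_2$; $\mathcal S<\mathrm E(d_2)$ is a space group (discrete, containing $d_2$ translations with linearly independent translation vectors) with translation subgroup $\mathcal T_{\mathcal S}$; $A\oplus(B|b)=(\mathrm{diag}(A,B)|(0,b))$. $\mathcal G$ is a discrete subgroup of $\mathrm E(d)$ contained in $\{A\oplus s:A\in\mathrm O(d_1),s\in\mathcal S\}$ projecting ($A\oplus s\mapsto s$) onto $\mathcal S$; $\mathcal T\subset\mathcal G$ maps bijectively onto $\mathcal T_{\mathcal S}$. There is $m_0\in\mathbb N$ such that $\mathcal T^N=\{t^N:t\in\mathcal T\}$ is a normal subgroup of $\mathcal G$ iff $N\in\mathcal M=m_0\mathbb N$, and then it is isomorphic to $\mathbb Z^{d_2}$ and of finite index; $\mathcal C_N$ is a fixed set of representatives of $\mathcal G/\mathcal T^N$. $U_{\mathrm{per}}$: maps $u:\mathcal G\to\mathbb R^d$ that are $\mathcal T^N$-periodic ($u(gt)=u(g)$ for $g\in\mathcal G,t\in\mathcal T^N$) for some $N\in\mathcal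 M$. $x_0\in\mathbb R^d$ with $g\mapsto g\cdot x_0$ injective; $d_{\mathrm{aff}}=\dim\mathrm{aff}(\mathcal G\cdot x_0)$; assumed $\mathcal G\cdot x_0\subset\{0_{d-d_{\mathrm{aff}}}\}\times\mathbb R^{d_{\mathrm{aff}}}$ and $\mathcal G$ acts trivially on $\mathbb R^{d-d_{\mathrm{aff}}}\times\{0_{d_{\mathrm{aff}}}\}$. For $\mathcal R\subset\mathcal G$: $U_{\mathrm{iso}}(\mathcal R)$ (resp. $U_{\mathrm{iso},0}(\mathcal R)$) is the set of $v:\mathcal R\to\mathbb R^d$ for which there are $a\in\mathbb R^d$ and $S\in\mathrm{Skew}(d)$ (resp. $S\in\mathrm{Skew}_{0,d_2}(d):=\{\begin{pmatrix}S_1&S_2\\-S_2^T&0\end{pmatrix}:S_1\in\mathrm{Skew}(d_1),S_2\in\mathbb R^{d_1\times d_2}\}$) with $\mathrm{rot}(g)v(g)=a+S(g\cdot x_0-x_0)$ for all $g\in\mathcal R$. For finite $\mathcal R$ and $\mathcal T^N$-periodic $u$: $\|u\|_{\mathcal R}=\big(\frac1{|\mathcal C_N|}\sum_{g\in\mathcal C_N}\mathrm{dist}(u(g\,\cdot)|_{\mathcal R},U_{\mathrm{iso}}(\mathcal R))^2\big)^{1/2}$ and $\|u\|_{\mathcal R,0}$ is defined likewise with $U_{\mathrm{iso},0}(\mathcal R)$; distances in the Euclidean norm on $(\mathbb R^d)^{\mathcal R}$. Property 1: $\mathcal R$ finite, $\mathrm{id}\in\mathcal R$, $\mathrm{aff}(\mathcal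 R\cdot x_0)=\mathrm{aff}(\mathcal G\cdot x_0)$. Property 2: $\mathcal R$ finite and there are $\mathcal R',\mathcal R''\subset\mathcal G$ with $\mathrm{id}\in\mathcal R'$, $\mathcal R'$ generating $\mathcal G$, $\mathcal R''$ having Property 1, and $\{gh:g\in\mathcal R',h\in\mathcal R''\}\subset\mathcal R$. *)

(* Defs.v *)
From HB Require Import structures.
From mathcomp Require Import all_boot all_order all_algebra.
From mathcomp Require Import finmap.
From mathcomp Require Import boolp classical_sets reals.
Set Implicit Arguments.
Unset Strict Implicit.
Unset Printing Implicit Defensive.
Import Order.TTheory GRing.Theory Num.Theory.
Local Open Scope fset_scope.
Local Open Scope classical_set_scope.
Local Open Scope ring_scope.

Section Euclid.
Variable R : realType.

(* Elements of E(n): pairs (A|b); membership in E(n) (A orthogonal) is a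
   separate predicate. *)
Definition Ed (n : nat) := ('M[R]_n * 'cV[R]_n)%type.

Definition is_orth n (A : 'M[R]_n) : Prop := A *m A^T = 1%:M.
Definition inE (n : nat) (g : Ed n) : Prop := is_orth g.1.

Definition eone n : Ed n := (1%:M, 0).
Definition emul n (g h : Ed n) : Ed n := (g.1 *m h.1, g.2 + g.1 *m h.2).
(* inverse of (A|b) with A orthogonal *)
Definition einv n (g : Ed n) : Ed n := (g.1^T, - (g.1^T *m g.2)).
Definition eact n (g : Ed n) (x : 'cV[R]_n) : 'cV[R]_n := g.1 *m x + g.2.
Definition rot n (g : Ed n) : 'M[R]_n := g.1.
Fixpoint epow n (g : Ed n) (k : nat) : Ed n :=
  if k is k'.+1 then emul g (epow g k') else eone n.

Definition esubgroup n (H : set (Ed n)) : Prop :=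
  [/\ H `<=` @inE n, H (eone n),
      (forall g h, H g -> H h -> H (emul g h)) &
      (forall g, H g -> H (einv g))].

(* discreteness: every point of H is isolated in H (for the product
   topology on 'M_n * 'cV_n, described with entrywise distances) *)
Definition ediscrete n (H : set (Ed n)) : Prop :=
  forall g, H g -> exists2 eps : R, 0 < eps &
    forall h, H h ->
      (forall i j, `|h.1 i j - g.1 i j| < eps) ->
      (forall i, `|h.2 i 0 - g.2 i 0| < eps) -> h = g.

Definition is_translation n (g : Ed n) : Prop := g.1 = 1%:M.

Definition space_group n (S : set (Ed n)) : Prop :=
  [/\ esubgroup S, ediscrete S &
      exists b : 'I_n -> 'cV[R]_n,
        (forall i, S (1%:M, b i)) /\ row_free (\matrix_(i < n) (b i)^T)].

Definition transl_subgroup n (S : set (Ed n)) : set (Ed n) :=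
  [set s | S s /\ is_translation s].

Definition dsum d1 d2 (A : 'M[R]_d1) (s : Ed d2) : Ed (d1 + d2) :=
  (block_mx A 0 0 s.1, col_mx 0 s.2).

Definition projS d1 d2 (g : Ed (d1 + d2)) : Ed d2 :=
  (drsubmx g.1, dsubmx g.2).

Definition normal_sub n (H G : set (Ed n)) : Prop :=
  [/\ esubgroup H, H `<=` G &
      forall g h, G g -> H h -> H (emul (emul g h) (einv g))].

Definition Tpow n (T : set (Ed n)) (N : nat) : set (Ed n) :=
  [set epow t N | t in T].

Definition representatives n (G H : set (Ed n)) (C : {fset Ed n}) : Prop :=
  [/\ (forall c, c \in C -> G c),
      (forall g, G g -> exists2 c, c \in C & exists2 t, H t & g = emul c t) &
      (forall c c', c \in C -> c' \in C ->
         (exists2 t, H t & c' = emul c t) -> c = c')].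

Definition generates n (Rp G : set (Ed n)) : Prop :=
  Rp `<=` G /\ (forall H, esubgroup H -> Rp `<=` H -> G `<=` H).

Definition aff n (X : set 'cV[R]_n) : set 'cV[R]_n :=
  [set y | exists k (p : 'I_k -> 'cV[R]_n) (lam : 'I_k -> R),
     [/\ forall i, X (p i), \sum_(i < k) lam i = 1 &
         y = \sum_(i < k) lam i *: p i]].

Definition aff_indep n k (p : 'I_k.+1 -> 'cV[R]_n) : bool :=
  row_free (\matrix_(i < k) (p (lift ord0 i) - p ord0)^T).
Definition aff_dim n (X : set 'cV[R]_n) (k : nat) : Prop :=
  (exists p : 'I_k.+1 -> 'cV[R]_n, (forall i, X (p i)) /\ aff_indep p) /\
  (forall k' (p : 'I_k'.+1 -> 'cV[R]_n),
     (forall i, X (p i)) -> aff_indep p -> (k' <= k)%N).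

Definition eorbit n (H : set (Ed n)) (x0 : 'cV[R]_n) : set 'cV[R]_n :=
  [set eact g x0 | g in H].

Definition skew n (S : 'M[R]_n) : Prop := S^T = - S.
Definition skew0 d1 d2 (S : 'M[R]_(d1 + d2)) : Prop :=
  skew S /\ drsubmx S = 0.

(* U_iso(Rs), U_iso,0(Rs): maps Rs -> R^n, represented by functions on Ed n
   of which only the values on Rs matter *)
Definition Uiso_gen n (Sk : 'M[R]_n -> Prop) (x0 : 'cV[R]_n)
  (Rs : {fset Ed n}) : set (Ed n -> 'cV[R]_n) :=
  [set v | exists (a : 'cV[R]_n) (S : 'M[R]_n), Sk S /\
     forall g, g \in Rs -> rot g *m v g = a + S *m (eact g x0 - x0)].
Definition Uiso n x0 Rs := @Uiso_gen n (@skew n) x0 Rs.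
Definition Uiso0 d1 d2 x0 Rs := @Uiso_gen (d1 + d2) (@skew0 d1 d2) x0 Rs.

Definition sqnorm n (x : 'cV[R]_n) : R := \sum_(i < n) x i 0 ^+ 2.
Definition normRs n (Rs : {fset Ed n}) (v : Ed n -> 'cV[R]_n) : R :=
  Num.sqrt (\sum_(h <- Rs) sqnorm (v h)).
Definition distRs n (Rs : {fset Ed n}) (v : Ed n -> 'cV[R]_n)
  (U : set (Ed n -> 'cV[R]_n)) : R :=
  inf [set normRs Rs (fun h => v h - w h) | w in U].

(* the seminorm: average over representatives C of G / T^N *)
Definition seminorm_gen n (U : set (Ed n -> 'cV[R]_n)) (Rs : {fset Ed n})
  (C : {fset Ed n}) (u : Ed n -> 'cV[R]_n) : R :=
  Num.sqrt ((#|` C|%:R)^-1 *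
    \sum_(g <- C) distRs Rs (fun h => u (emul g h)) U ^+ 2).
Definition seminormR n x0 Rs C u := @seminorm_gen n (Uiso x0 Rs) Rs C u.
Definition seminormR0 d1 d2 (x0 : 'cV[R]_(d1 + d2)) (Rs C : {fset Ed (d1 + d2)})
  (u : Ed (d1 + d2) -> 'cV[R]_(d1 + d2)) : R :=
  @seminorm_gen (d1 + d2) (@Uiso0 d1 d2 x0 Rs) Rs C u.

(* u : G -> R^n is H-periodic (values of u outside G are irrelevant) *)
Definition periodic n (G H : set (Ed n)) (u : Ed n -> 'cV[R]_n) : Prop :=
  forall g t, G g -> H t -> u (emul g t) = u g.

Definition property1 n (G : set (Ed n)) (x0 : 'cV[R]_n) (Rs : {fset Ed n})
  : Prop :=
  [/\ [set` Rs] `<=` G, eone n \in Rs &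
      aff (eorbit [set` Rs] x0) = aff (eorbit G x0)].

Definition property2 n (G : set (Ed n)) (x0 : 'cV[R]_n) (Rs : {fset Ed n})
  : Prop :=
  [set` Rs] `<=` G /\
  exists (R' : set (Ed n)) (R'' : {fset Ed n}),
    [/\ R' (eone n), generates R' G, property1 G x0 R'' &
        forall g h, R' g -> h \in R'' -> emul g h \in Rs].

End Euclid.
Arguments projS {R d1 d2}.
Arguments dsum {R d1 d2}.
Arguments seminormR0 {R d1 d2}.
Arguments Uiso0 {R d1 d2}.
Arguments skew0 {R d1 d2}.

(* Main.v *)
(* Rs-patches around neighbouring group elements overlap in affinely spanning
   sets, so almost optimal infinitesimal rigid motions of the patches around g
   and gk agree for every fixed k, up to the rigidity defects of finitely many
   neighbours of g. Hence u is locally close to a rigid motion on arbitrary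
   finite patches. Let t_1, ..., t_d2 be independent commuting elements of
   T^m0. For a polynomial p_i with p_i(1) = 0 and p_i'(1) = 1 annihilating the
   O(d1) part of t_i, the difference operator L_i = p_i(right shift by t_i)
   maps the lower part u_2 of u to D tau_i up to a small error, where tau_i is
   the translation vector of t_i and D the lower right block of the skew matrix
   of the local rigid motion. The scalars psi_ij = tau_i . D tau_j are skew and
   L_j phi_i is close to psi_ij for phi_i = tau_i . u_2. As in the proof of the
   periodic Korn inequality, the sum of (L_j phi_i)(L_i phi_j) over a period
   equals that of (L_i^* phi_i)(L_j^* phi_j), which is small because the L_i are
   normal operators and psi_ii = 0. So D is small in l^2, and replacing it by 0
   costs only a constant. *)
Require Import Defs.
From HB Require Import structures.
From mathcomp Require Import all_boot all_order all_algebra.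
From mathcomp Require Import finmap.
From mathcomp Require Import boolp classical_sets reals.
From mathcomp Require Import ring lra.
Import Order.TTheory GRing.Theory Num.Theory.
Local Open Scope fset_scope.
Local Open Scope classical_set_scope.
Local Open Scope ring_scope.

(** * Group laws of E(n) *)

Section EuclideanGroup.
Variables (R : realType) (n : nat).
Implicit Types (g h k : Ed R n) (G H : set (Ed R n)).

Lemma emulA g h k : emul (emul g h) k = emul g (emul h k).
Proof. by rewrite /emul /= mulmxA mulmxDr mulmxA addrA. Qed.

Lemma emul1e g : emul (eone R n) g = g.
Proof. by case: g => A b; rewrite /emul /= !mul1mx add0r. Qed.

Lemma emule1 g : emul g (eone R n) = g.
Proof. by case: g => A b; rewrite /emul /= mulmx1 mulmx0 addr0. Qed.

Lemma emulVe g : Defs.inE g -> emul (einv g) g = eone R n.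
Proof.
case: g => A b; rewrite /Defs.inE /is_orth /emul /eone /= => AAT.
by rewrite (mulmx1C AAT) addNr.
Qed.

Lemma emuleV g : Defs.inE g -> emul g (einv g) = eone R n.
Proof.
case: g => A b; rewrite /Defs.inE /is_orth /emul /eone /= => AAT.
by rewrite AAT mulmxN mulmxA AAT mul1mx subrr.
Qed.

Lemma eact_mul g h (x : 'cV[R]_n) : eact (emul g h) x = eact g (eact h x).
Proof. by rewrite /eact /= mulmxDr -mulmxA -addrA (addrC g.2). Qed.

Lemma epow_in G g m : esubgroup G -> G g -> G (epow g m).
Proof. by case=> _ G1 GM _ Gg; elim: m => //= m IH; apply: GM. Qed.

Lemma emulI H g h k : esubgroup H -> H g -> emul g h = emul g k -> h = k.
Proof.
case=> Hin _ _ _ Hg e.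
by rewrite -(emul1e h) -(emulVe g (Hin _ Hg)) emulA e -emulA emulVe ?emul1e //; apply: Hin.
Qed.

End EuclideanGroup.

(** * Comparison of l^1 and Euclidean norms *)

Section L1.
Variable R : realType.

Definition l1 {n} (v : 'cV[R]_n) : R := \sum_(i < n) `|v i 0|.

Lemma l1_ge0 n (v : 'cV[R]_n) : 0 <= l1 v.
Proof. by apply: sumr_ge0. Qed.

Lemma l10 n : l1 (0 : 'cV[R]_n) = 0.
Proof. by apply: big1 => i _; rewrite mxE normr0. Qed.

Lemma l1D n (v w : 'cV[R]_n) : l1 (v + w) <= l1 v + l1 w.
Proof. by rewrite -big_split /=; apply: ler_sum => i _; rewrite mxE ler_normD. Qed.

Lemma coord_l1 n (v : 'cV[R]_n) i : `|v i 0| <= l1 v.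
Proof. by rewrite /l1 (bigD1 i) //= lerDl sumr_ge0. Qed.

Lemma l1_col0mx m n (v : 'cV[R]_n) : l1 (col_mx (0 : 'cV_m) v) = l1 v.
Proof.
rewrite /l1 big_split_ord /= big1 ?add0r => [|k _]; last by rewrite col_mxEu mxE normr0.
by apply: eq_bigr => k _; rewrite col_mxEd.
Qed.

Definition mx_l1 {m n} (A : 'M[R]_(m, n)) : R := \sum_i \sum_j `|A i j|.

Lemma mx_l1_ge0 m n (A : 'M[R]_(m, n)) : 0 <= mx_l1 A.
Proof. by apply: sumr_ge0 => i _; apply: sumr_ge0. Qed.

Lemma l1_mulmx m n (A : 'M[R]_(m, n)) v : l1 (A *m v) <= mx_l1 A * l1 v.
Proof.
rewrite /mx_l1 mulr_suml; apply: ler_sum => i _.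
rewrite mxE mulr_suml; apply: (le_trans (ler_norm_sum _ _ _)).
by apply: ler_sum => j _; rewrite normrM ler_wpM2l // coord_l1.
Qed.

Lemma sqnorm_ge0 n (v : 'cV[R]_n) : 0 <= sqnorm v.
Proof. by apply: sumr_ge0 => i _; apply: sqr_ge0. Qed.

Lemma sqr_l1_le n (v : 'cV[R]_n) : sqnorm v <= l1 v ^+ 2.
Proof.
rewrite expr2 /sqnorm {1}/l1 mulr_suml; apply: ler_sum => i _.
by rewrite -real_normK ?num_real // expr2 ler_wpM2l // coord_l1.
Qed.

Lemma normRs_ge0 n (Rs : {fset Ed R n}) v : 0 <= normRs Rs v.
Proof. exact: sqrtr_ge0. Qed.

Lemma l1_le_normRs n (Rs : {fset Ed R n}) v h :
  h \in Rs -> l1 (v h) <= n%:R * normRs Rs v.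
Proof.
move=> hRs; rewrite -[X in X%:R](card_ord n) mulr_natl -sumr_const.
apply: ler_sum => i _; rewrite /normRs -sqrtr_sqr ler_wsqrtr //.
rewrite (big_fsetD1 h) //= -[leLHS]addr0 lerD ?sumr_ge0 //; last first.
  by move=> *; apply: sqnorm_ge0.
by rewrite /sqnorm (bigD1 i) //= lerDl sumr_ge0 // => j _; apply: sqr_ge0.
Qed.

Lemma normRs_le_l1 n (Rs : {fset Ed R n}) v : normRs Rs v <= \sum_(h <- Rs) l1 (v h).
Proof.
have s0 (r : seq (Ed R n)) : 0 <= \sum_(h <- r) l1 (v h).
  by apply: sumr_ge0 => *; apply: l1_ge0.
rewrite /normRs -[leRHS]ger0_norm // -sqrtr_sqr ler_wsqrtr //.
elim: (enum_fset Rs) => [|h r IH]; first by rewrite !big_nil expr0n.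
rewrite !big_cons.
have := sqr_l1_le _ (v h); have := s0 r; have := l1_ge0 _ (v h).
by move: IH; set a := \sum_(_ <- _) _; set b := \sum_(_ <- _) _; nra.
Qed.

Lemma sqr_sum_le (I : Type) (r : seq I) (f : I -> R) :
  (\sum_(i <- r) f i) ^+ 2 <= (size r)%:R * \sum_(i <- r) f i ^+ 2.
Proof.
elim: r => [|x r IH]; first by rewrite !big_nil expr0n mulr0.
rewrite !big_cons /= -natr1.
set s := \sum_(i <- r) f i in IH *; set q := \sum_(i <- r) _ in IH *.
case: r @s @q IH => [|y r] s q IH.
  by rewrite /s /q !big_nil !addr0 add0r mul1r.
set k : R := (size _)%:R in IH *.
have k0 : 0 < k by rewrite ltr0n.
have : 0 <= (k * f x - s) ^+ 2 := sqr_ge0 _.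
move=> H; rewrite -(ler_pM2l k0).
have : k * s ^+ 2 <= k * (k * q) by rewrite ler_wpM2l // ltW.
by move: H IH; move: (f x) => z; lra.
Qed.

End L1.

Arguments l1 {R n}.
Arguments mx_l1 {R m n}.

(** * Polynomials annihilating an orthogonal matrix *)

Section Orthogonal.
Variable R : realType.

(** [y] lies in the image of [A - 1%:M] and is fixed by [A], hence by [A^T]; so it is orthogonal to
    that image, in particular to itself. *)
Lemma orthogonal_semisimple1 n (A : 'M[R]_n) v :
  is_orth A -> (A - 1%:M) *m ((A - 1%:M) *m v) = 0 -> (A - 1%:M) *m v = 0 :> 'cV_n.
Proof.
move=> AAT; set y := _ *m v => /eqP.
rewrite mulmxBl mul1mx subr_eq0 => /eqP Ay.
have ATy : A^T *m y = y by rewrite -{1}Ay mulmxA (mulmx1C AAT) mul1mx.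
have : y^T *m y = 0.
  rewrite {2}/y mulmxBl mul1mx mulmxBr mulmxA -{1}[A]trmxK -trmx_mul ATy subrr //.
move=> /matrixP/(_ 0 0); rewrite !mxE => /eqP.
rewrite psumr_eq0 => [/allP y0|i _]; last by rewrite mxE -expr2 sqr_ge0.
apply/matrixP=> i j; rewrite ord1 [RHS]mxE; have := y0 i (mem_index_enum _).
by rewrite mxE /= -expr2 sqrf_eq0 => /eqP.
Qed.

(* 1 is a semisimple eigenvalue of an orthogonal matrix, so the squarefree
   part at 1 of the characteristic polynomial still annihilates it. *)
Lemma orthogonal_annihilator n (A : 'M[R]_n) : is_orth A ->
  exists p : {poly R}, [/\ p.[1] = 0, p^`().[1] = 1 &
    forall v : 'cV_n, \sum_(i < size p) p`_i *: iter i (mulmx A) v = 0].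
Proof.
case: n A => [|n] A oA.
  exists ('X - 1); split; rewrite ?hornerE ?subrr // ?derivE ?hornerE ?subr0 //.
  by move=> v; apply/matrixP => -[].
have [m [q]] := multiplicity_XsubC (char_poly A) 1.
rewrite monic_neq0 ?char_poly_monic //= => q1 chi.
have CH := Cayley_Hamilton A; rewrite chi in CH.
have powE i v : iter i (mulmx A) v = A ^+ i *m v :> 'cV_n.+1.
  by elim: i => [|i IH]; rewrite ?mul1mx //= IH exprS mulmxA.
have {}CH v : (A - 1%:M) *m (horner_mx A q *m v) = 0 :> 'cV_n.+1.
  have : horner_mx A q *m v = 0 \/ exists m, iter m.+1 (mulmx (A - 1%:M)) (horner_mx A q *m v) = 0.
    have := congr1 (fun M => M *m v) CH; rewrite mul0mx mulrC rmorphM rmorphXn.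
    rewrite rmorphB /= horner_mx_X horner_mx_C -mulmxA.
    have powE' i w : iter i (mulmx (A - 1%:M)) w = (A - 1%:M) ^+ i *m w :> 'cV_n.+1.
      by elim: i => [|i IH]; rewrite ?mul1mx //= IH exprS mulmxA.
    rewrite -powE'; case: (m) => [|m' e]; first by left.
    by right; exists m'.
  case=> [->|]; first by rewrite mulmx0.
  case=> m'; elim: m' => //= m' IH /(orthogonal_semisimple1 _ _ _ oA); exact: IH.
have q10 : q.[1] != 0 by [].
(* The derivative of [('X - 1%:P) * q] at 1 is [q.[1]], whence the scaling. *)
exists (q.[1]^-1 *: (('X - 1%:P) * q)); split.
- by rewrite hornerZ hornerM hornerXsubC subrr mul0r mulr0.
- rewrite derivZ derivM derivXsubC hornerZ hornerD !hornerM hornerXsubC hornerC.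
  by rewrite subrr mul0r addr0 mul1r mulVf.
move=> v; under eq_bigr do rewrite powE scalemxAl.
rewrite -mulmx_suml; set p := _ *: _.
have -> : \sum_(i < size p) p`_i *: A ^+ i = horner_mx A p.
  rewrite -[in RHS](coefK p) poly_def linear_sum; apply: eq_bigr => i _.
  by rewrite linearZ rmorphXn /= horner_mx_X.
rewrite /p linearZ rmorphM rmorphB /= horner_mx_X horner_mx_C.
by rewrite -scalemxAl -mulmxA CH scaler0.
Qed.

End Orthogonal.

(** * Quantities bounded by local rigidity defects *)

Section Controlled.
Variables (R : realType) (n : nat) (G : set (Ed R n)) (x0 : 'cV[R]_n).
Variable Rs : {fset Ed R n}.
Hypothesis Ggrp : esubgroup G.

Let Gmul g h : G g -> G h -> G (emul g h). Proof. by case: Ggrp => _ _ + _; apply. Qed.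
Let Ginv g : G g -> G (einv g). Proof. by case: Ggrp => _ _ _; apply. Qed.
Let GinE g : G g -> Defs.inE g. Proof. by case: Ggrp => + _ _ _; apply. Qed.

Definition rigid (a : Ed R n -> 'cV[R]_n) (B : Ed R n -> 'M[R]_n) g h : 'cV[R]_n :=
  a g + B g *m (eact h x0 - x0).

(** [F] is any bound on the defect, so that motions that only nearly attain the distance are
    allowed. *)
Definition locally_rigid u a B (F : Ed R n -> R) : Prop :=
  forall g, G g -> 0 <= F g /\
    forall h, h \in Rs -> l1 (h.1 *m u (emul g h) - rigid a B g h) <= F g.

(* [Phi] at [g] is bounded by the rigidity defects of finitely many neighbours
   of [g], with neighbours and constant independent of the displacement [u]. *)
Definition controlled p
    (Phi : (Ed R n -> 'cV[R]_n) -> (Ed R n -> 'cV[R]_n) -> (Ed R n -> 'M[R]_n) ->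
           Ed R n -> 'cV[R]_p) : Prop :=
  exists K (Q : seq (Ed R n)), [/\ 0 <= K, forall q, q \in Q -> G q &
    forall u a B F, locally_rigid u a B F -> forall g, G g ->
      l1 (Phi u a B g) <= K * \sum_(q <- Q) F (emul g q)].

Lemma controlled_ext p (Phi Psi : _ -> _ -> _ -> _ -> 'cV_p) :
  controlled p Phi -> (forall u a B g, G g -> Psi u a B g = Phi u a B g) ->
  controlled p Psi.
Proof.
by case=> K [Q [K0 GQ H]] e; exists K, Q; split=> // u a B F L g Gg; rewrite e //; apply: H.
Qed.

Let defect_ge0 u a B F g (Q : seq (Ed R n)) : locally_rigid u a B F -> G g ->
  (forall q, q \in Q -> G q) -> 0 <= \sum_(q <- Q) F (emul g q).
Proof.
move=> L Gg GQ; rewrite big_seq sumr_ge0 // => q /GQ Gq.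
by have [] := L _ (Gmul _ _ Gg Gq).
Qed.

Lemma controlled0 p : controlled p (fun _ _ _ _ => 0).
Proof. by exists 0, [::]; split=> // *; rewrite l10 mul0r. Qed.

Lemma controlledD p (Phi Psi : _ -> _ -> _ -> _ -> 'cV_p) :
  controlled p Phi -> controlled p Psi ->
  controlled p (fun u a B g => Phi u a B g + Psi u a B g).
Proof.
move=> [K [Q [K0 GQ H]]] [K' [Q' [K'0 GQ' H']]].
exists (K + K'), (Q ++ Q'); split=> [|q|u a B F L g Gg]; first exact: addr_ge0.
  by rewrite mem_cat => /orP[/GQ|/GQ'].
have := H _ _ _ _ L g Gg; have := H' _ _ _ _ L g Gg; rewrite big_cat /=.
have := l1D _ _ (Phi u a B g) (Psi u a B g).
have := defect_ge0 _ _ _ _ _ _ L Gg GQ; have := defect_ge0 _ _ _ _ _ _ L Gg GQ'.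
set s := \sum_(_ <- _) _; set s' := \sum_(_ <- _) _.
move: (l1 _) (l1 _) (l1 _) => x y z; nra.
Qed.

Lemma controlled_mulmx p m (A : 'M_(m, p)) Phi :
  controlled p Phi -> controlled m (fun u a B g => A *m Phi u a B g).
Proof.
case=> K [Q [K0 GQ H]]; exists (mx_l1 A * K), Q.
split=> // [|u a B F L g Gg]; first by rewrite mulr_ge0 ?mx_l1_ge0.
by rewrite (le_trans (l1_mulmx _ _ _ _ _)) // -mulrA ler_wpM2l ?mx_l1_ge0 // (H _ _ _ F).
Qed.

Lemma controlled_scale p c Phi :
  controlled p Phi -> controlled p (fun u a B g => c *: Phi u a B g).
Proof.
move=> /(controlled_mulmx _ _ c%:M)/controlled_ext; apply=> *.
by rewrite mul_scalar_mx.
Qed.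

Lemma controlled_sum p (I : Type) (r : seq I) (Phi : I -> _ -> _ -> _ -> _ -> 'cV_p) :
  (forall i, controlled p (Phi i)) ->
  controlled p (fun u a B g => \sum_(i <- r) Phi i u a B g).
Proof.
move=> H; elim: r => [|i r IH].
  by apply: controlled_ext (controlled0 p) _ => *; rewrite big_nil.
by apply: controlled_ext (controlledD _ _ _ (H i) IH) _ => *; rewrite big_cons.
Qed.

Lemma controlled_shift p k Phi :
  G k -> controlled p Phi -> controlled p (fun u a B g => Phi u a B (emul g k)).
Proof.
move=> Gk [K [Q [K0 GQ H]]]; exists K, [seq emul k q | q <- Q].
split=> // [q /mapP[q' /GQ Gq' ->]|u a B F L g Gg]; first exact: Gmul.
rewrite big_map; under eq_bigr do rewrite -emulA.
by apply: H => //; apply: Gmul.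
Qed.

Lemma controlled_patch h : h \in Rs ->
  controlled n (fun u a B g => h.1 *m u (emul g h) - rigid a B g h).
Proof.
move=> hRs; have [_ G1 _ _] := Ggrp; exists 1, [:: eone R n].
split=> // [q|u a B F L g Gg]; first by rewrite inE => /eqP->.
by rewrite big_seq1 mul1r emule1; apply: (L g Gg).2.
Qed.

Lemma rigid_affine k (lam : 'I_k -> R) (hs : 'I_k -> Ed R n) a B g h :
  \sum_i lam i = 1 -> eact h x0 = \sum_i lam i *: eact (hs i) x0 ->
  rigid a B g h = \sum_i lam i *: rigid a B g (hs i).
Proof.
move=> lam1 e; rewrite /rigid e.
under [RHS]eq_bigr do rewrite scalerDr scalemxAr scalerBr.
rewrite big_split /= -scaler_suml lam1 scale1r -mulmx_sumr sumrB.
by rewrite -[in RHS]scaler_suml lam1 scale1r.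
Qed.

(** [k.1] brings the motion fitted around [gk] into the frame of [g]. Asking for every [h] in [G],
    beyond the patch, lets the relation pass to products. *)
Definition compatible k := G k /\ forall h, G h ->
  controlled n (fun u a B g =>
    k.1 *m rigid a B (emul g k) h - rigid a B g (emul k h)).

(** The mismatch of [kl] at [h] telescopes into [k.1] times the shifted mismatch of [l] at [h] and
    the mismatch of [k] at [lh]. For the inverse, the mismatch of [k] is shifted by [einv k]. *)
Lemma compatible_subgroup : esubgroup compatible.
Proof.
have [_ G1 _ _] := Ggrp; split=> [k [/GinE//]||k l [Gk Hk] [Gl Hl]|k [Gk Hk]].
- split=> // h Gh; apply: controlled_ext (controlled0 n) _ => u a B g Gg.
  by rewrite mul1mx emule1 emul1e subrr.
- split=> [|h Gh]; first exact: Gmul.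
  have C1 := controlled_mulmx _ _ k.1 _ (controlled_shift _ _ _ Gk (Hl h Gh)).
  have C2 := Hk _ (Gmul _ _ Gl Gh).
  apply: controlled_ext (controlledD _ _ _ C1 C2) _ => u a B g Gg.
  by rewrite mulmxBr addrA subrK !emulA mulmxA.
- split=> [|h Gh]; first exact: Ginv.
  have Gk' := Ginv _ Gk.
  have C1 := controlled_shift _ _ _ Gk' (Hk _ (Gmul _ _ Gk' Gh)).
  apply: controlled_ext (controlled_mulmx _ _ (- k.1^T) _ C1) _ => u a B g Gg.
  rewrite mulNmx mulmxBr opprB mulmxA (mulmx1C (GinE _ Gk)) mul1mx.
  have iE := GinE _ Gk.
  by rewrite !emulA (emulVe _ _ _ iE) emule1 -(emulA _ _ k) (emuleV _ _ _ iE) emul1e.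
Qed.

(* Two patches whose overlap affinely spans the orbit have almost the same
   rigid approximation, and this propagates along words in the generators. *)
Lemma compatible_full : property2 G x0 Rs -> G `<=` compatible.
Proof.
case=> RsG [R' [R'' [R'1 [R'G gen] [R''G R''1 affE] mulR]]].
apply: gen; first exact: compatible_subgroup.
move=> r R'r; have Gr := R'G _ R'r; split=> // h Gh.
have : aff (eorbit G x0) (eact h x0).
  exists 1%N, (fun=> eact h x0), (fun=> 1); split=> [i||]; first by exists h.
    by rewrite big_ord1.
  by rewrite big_ord1 scale1r.
rewrite -affE => -[k [p [lam [pR lam1 hE]]]].
have /choice[hs hsP] : forall i, exists h', h' \in R'' /\ p i = eact h' x0.
  by move=> i; have [h' ? <-] := pR i; exists h'.
have {}hE : eact h x0 = \sum_i lam i *: eact (hs i) x0.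
  by rewrite hE; apply: eq_bigr => i _; rewrite (hsP i).2.
have rhE : eact (emul r h) x0 = \sum_i lam i *: eact (emul r (hs i)) x0.
  rewrite eact_mul hE; under [RHS]eq_bigr do rewrite eact_mul /eact scalerDr scalemxAr.
  by rewrite big_split /= -scaler_suml lam1 scale1r -mulmx_sumr.
have C i : controlled n (fun u a B g => lam i *:
    (r.1 *m rigid a B (emul g r) (hs i) - rigid a B g (emul r (hs i)))).
  have hR := (hsP i).1.
  have hRs : hs i \in Rs by rewrite -(emul1e _ _ (hs i)); apply: mulR.
  have rhRs : emul r (hs i) \in Rs by apply: mulR.
  apply: controlled_scale.
  (* The patches around [gr] and around [g] both see the value of [u] at [g r (hs i)]; subtracting
     the two estimates eliminates it. *)
  have C1 := controlled_mulmx _ _ (- r.1) _ (controlled_shift _ _ _ Gr (controlled_patch _ hRs)).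
  apply: controlled_ext (controlledD _ _ _ C1 (controlled_patch _ rhRs)) _ => u a B g Gg.
  by rewrite mulNmx mulmxBr opprB mulmxA emulA addrA subrK.
apply: controlled_ext (controlled_sum _ _ (index_enum _) _ C) _ => u a B g Gg.
rewrite (rigid_affine _ _ _ _ _ _ _ lam1 hE) (rigid_affine _ _ _ _ _ _ _ lam1 rhE).
rewrite mulmx_sumr -sumrB; apply: eq_bigr => i _.
by rewrite scalerBr scalemxAr.
Qed.

(** The patch of [gk] contains [gk] itself, and compatibility of [k] at the identity carries the
    estimate there back to the motion around [g]. *)
Lemma controlled_displacement k : property2 G x0 Rs -> G k ->
  controlled n (fun u a B g => k.1 *m u (emul g k) - rigid a B g k).
Proof.
move=> P2 Gk; have [_ G1 _ _] := Ggrp.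
have Rs1 : eone R n \in Rs.
  case: P2 => _ [R' [R'' [R'1 _ [_ R''1 _] mulR]]].
  by rewrite -(emul1e _ _ (eone R n)) mulR.
have [_ C2] := compatible_full P2 k Gk.
have C1 := controlled_mulmx _ _ k.1 _ (controlled_shift _ _ _ Gk (controlled_patch _ Rs1)).
apply: controlled_ext (controlledD _ _ _ C1 (C2 _ G1)) _ => u a B g Gg.
by rewrite mulmxBr addrA subrK !emule1 mul1mx.
Qed.

End Controlled.

(** * Sums over a period and summation by parts *)

Section Average.
Variables (R : realType) (n : nat) (G H : set (Ed R n)) (C : {fset Ed R n}).
Hypotheses (Ggrp : esubgroup G) (HG : normal_sub H G) (repC : representatives G H C).

Definition right_invariant (F : Ed R n -> R) : Prop :=
  forall g t, G g -> H t -> F (emul g t) = F g.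

Let GM g h : G g -> G h -> G (emul g h). Proof. by case: Ggrp => _ _ + _; apply. Qed.
Let GV g : G g -> G (einv g). Proof. by case: Ggrp => _ _ _; apply. Qed.
Let GE g : G g -> Defs.inE g. Proof. by case: Ggrp => + _ _ _; apply. Qed.
Let HM g h : H g -> H h -> H (emul g h).
Proof. by case: HG => -[_ _ + _] _ _; apply. Qed.
Let HV g : H g -> H (einv g). Proof. by case: HG => -[_ _ _ +] _ _; apply. Qed.
Let HGs g : H g -> G g. Proof. by case: HG => _ + _; apply. Qed.

Lemma emul_normal q t : G q -> H t -> exists2 t', H t' & emul t q = emul q t'.
Proof.
move=> Gq Ht; exists (emul (einv q) (emul t q)).
  have [_ _ J] := HG; have := J _ _ (GV _ Gq) Ht.
  suff -> : einv (einv q) = q by rewrite emulA.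
  have Gq' := GV _ Gq; apply: (emulI _ _ G (einv q)) => //.
  by rewrite emuleV ?emulVe //; apply: GE.
by rewrite -emulA emuleV ?emul1e //; apply: GE.
Qed.

Lemma right_invariant_shift F q :
  G q -> right_invariant F -> right_invariant (fun g => F (emul g q)).
Proof.
move=> Gq iF g t Gg Ht; have [t' Ht' e] := emul_normal _ _ Gq Ht.
by rewrite emulA e -emulA iF //; apply: GM.
Qed.

(* Right translation by [q] permutes the cosets of the normal subgroup [H]. *)
Lemma sum_shift F q : G q -> right_invariant F ->
  \sum_(g <- C) F (emul g q) = \sum_(g <- C) F g.
Proof.
move=> Gq iF; have [CG Cex Cinj] := repC.
have /choice[s sP] : forall c : C, exists c' : C, exists2 t, H t &
    emul (val c) q = emul (val c') t.
  move=> c; have [c' c'C [t Ht e]] := Cex _ (GM _ _ (CG _ (valP c)) Gq).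
  by exists [` c'C]%fset, t.
rewrite !big_seq_fsetE /= [RHS](reindex_inj (h := s)); last first.
  move=> c c' scc'; apply/val_inj; apply: Cinj; [exact: valP|exact: valP|].
  have Gc := CG _ (valP c); have Gc' := CG _ (valP c').
  have [t Ht e] := sP c; have [t' Ht' e'] := sP c'.
  have [t1 Ht1 e1] := emul_normal _ _ (GV _ Gq) (HM _ _ (HV _ Ht) Ht').
  exists t1 => //.
  rewrite -(emule1 _ _ (val c')) -(emuleV _ _ _ (GE _ Gq)) -emulA e' -scc'.
  have -> : emul (val (s c)) t' = emul (val c) (emul q (emul (einv t) t')).
    rewrite -emulA e emulA -(emulA _ _ t) (emuleV _ _ t) ?emul1e //.
    by apply: GE; apply: HGs.
  by rewrite !emulA -(emulA _ _ (einv t)) e1 -(emulA _ _ q) emuleV ?emul1e //; apply: GE.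
apply: eq_bigr => c _; have [t Ht ->] := sP c.
by apply: iF => //; apply: CG; apply: valP.
Qed.

Definition shift_comb (r : seq (R * Ed R n)) (phi : Ed R n -> R) g : R :=
  \sum_(x <- r) x.1 * phi (emul g x.2).
(** The adjoint of [shift_comb r] on right-invariant functions, paired by sums over [C]. *)
Definition shift_adj (r : seq (R * Ed R n)) (phi : Ed R n -> R) g : R :=
  \sum_(x <- r) x.1 * phi (emul g (einv x.2)).

(** Term by term, replacing [g] by [g x y] in the adjoint sum leaves [x] in the argument of [phi]
    and, by commutation, [y] in that of [chi]. *)
Lemma sum_shift_adj r r' phi chi :
  (forall x, x \in r -> G x.2) -> (forall x, x \in r' -> G x.2) ->
  (forall x y, x \in r -> y \in r' -> emul x.2 y.2 = emul y.2 x.2) ->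
  right_invariant phi -> right_invariant chi ->
  \sum_(g <- C) shift_comb r phi g * shift_comb r' chi g =
  \sum_(g <- C) shift_adj r' phi g * shift_adj r chi g.
Proof.
move=> rG r'G com iphi ichi.
under eq_bigr do rewrite mulr_suml; under [RHS]eq_bigr do rewrite mulr_sumr.
rewrite exchange_big [RHS]exchange_big; apply: eq_big_seq => x xr.
under eq_bigr do rewrite mulr_sumr; under [RHS]eq_bigr do rewrite mulr_suml.
rewrite exchange_big [RHS]exchange_big; apply: eq_big_seq => y yr /=.
have Gx := rG _ xr; have Gy := r'G _ yr.
pose F g := x.1 * y.1 * (phi (emul g (einv y.2)) * chi (emul g (einv x.2))).
transitivity (\sum_(g <- C) F g); last by apply: eq_bigr => g _; rewrite /F; ring.
rewrite -(sum_shift F (emul x.2 y.2)) //; first last.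
- move=> g t Gg Ht; rewrite /F.
  by rewrite !(right_invariant_shift _ _ _ _ _ _ _ Ht) //; apply: GV.
- exact: GM.
apply: eq_bigr => g _; rewrite /F emulA (emulA _ _ x.2) emuleV; last exact: GE.
rewrite emule1 com // emulA (emulA _ _ y.2) emuleV; last exact: GE.
by rewrite emule1; ring.
Qed.

(* Discrete integration by parts turns the cross term of the symmetrised
   gradient into a product of the diagonal terms [L_i phi_i], on which the
   skew field [psi] does not contribute; adjoints have equal norms since the
   operators [L_i] are normal. *)
Lemma discrete_korn m (r : 'I_m -> seq (R * Ed R n)) (phi : 'I_m -> Ed R n -> R)
    (psi : 'I_m -> 'I_m -> Ed R n -> R) (M : R) :
  (forall i x, x \in r i -> G x.2) ->
  (forall i j x y, x \in r i -> y \in r j -> emul x.2 y.2 = emul y.2 x.2) ->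
  (forall i, right_invariant (phi i)) ->
  (forall i j g, psi i j g = - psi j i g) ->
  (forall i j, \sum_(g <- C) (shift_comb (r j) (phi i) g - psi i j g) ^+ 2 <= M) ->
  forall i j, \sum_(g <- C) psi i j g ^+ 2 <= 8 * M.
Proof.
move=> rG com iphi skewpsi errM i j.
have psi0 k g : psi k k g = 0 by have := skewpsi k k g; lra.
(* Two equal operators in [sum_shift_adj] give normality: [L_k] and its adjoint have equal norm on
   [phi k], and [psi k k] vanishes. *)
have adjM k : \sum_(g <- C) shift_adj (r k) (phi k) g ^+ 2 <= M.
  apply: le_trans (errM k k); rewrite le_eqVlt; apply/orP; left; apply/eqP.
  under [RHS]eq_bigr do rewrite psi0 subr0 expr2.
  by rewrite (sum_shift_adj (r k) (r k) (phi k) (phi k)); eauto.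
set X := shift_comb (r j) (phi i); set Y := shift_comb (r i) (phi j).
set Z := shift_adj (r i) (phi i) in adjM *; set W := shift_adj (r j) (phi j).
have XY : \sum_(g <- C) X g * Y g = \sum_(g <- C) Z g * W g.
  by apply: sum_shift_adj; eauto.
(* With [e = X - psi i j] and [f = Y - psi j i], the square of [psi i j] is
   [- X Y + psi i j (f - e) + e f]. Absorbing half of it on the left leaves at most the weights 3.
   These give 6 of the final 8, the product gives 2. *)
have pointwise : \sum_(g <- C) psi i j g ^+ 2 <= \sum_(g <- C)
   (-2 * (X g * Y g) + 3 * (X g - psi i j g) ^+ 2 + 3 * (Y g - psi j i g) ^+ 2).
  apply: ler_sum => g _; rewrite (skewpsi j i).
  set p := psi i j g; set x := X g; set y := Y g.
  have := sqr_ge0 (p - (y + p - (x - p))); have := sqr_ge0 ((x - p) + (y + p)).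
  have := sqr_ge0 ((x - p) - (y + p)).
  nra.
apply: (le_trans pointwise); rewrite !big_split /= -!mulr_sumr XY.
have ZW : -2 * \sum_(g <- C) Z g * W g <= \sum_(g <- C) Z g ^+ 2 + \sum_(g <- C) W g ^+ 2.
  rewrite mulr_sumr -big_split; apply: ler_sum => g _ /=.
  by have := sqr_ge0 (Z g + W g); nra.
have := adjM i; have := adjM j; have := errM i j; have := errM j i.
rewrite -/X -/Y -/Z -/W; move: ZW.
lra.
Qed.

End Average.

(** Cauchy-Schwarz over [Q] gives one factor [size Q], translation invariance of the sum over [C]
    the other. The constant precedes [H] and [C], hence is uniform in the period. *)
Lemma controlled_l2 (R : realType) n (G : set (Ed R n)) x0 Rs p
    (Phi : _ -> _ -> _ -> _ -> 'cV_p) :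
  esubgroup G -> controlled R n G x0 Rs p Phi ->
  exists2 K, 0 <= K & forall H C, normal_sub H G -> representatives G H C ->
    forall u a B F, locally_rigid R n G x0 Rs u a B F -> right_invariant R n G H F ->
    \sum_(g <- C) l1 (Phi u a B g) ^+ 2 <= K * \sum_(g <- C) F g ^+ 2.
Proof.
move=> Ggrp [K [Q [K0 GQ bound]]].
exists (K ^+ 2 * (size Q)%:R * (size Q)%:R); first by rewrite !mulr_ge0 ?sqr_ge0.
move=> H C HG repC u a B F L iF; have [CG _ _] := repC.
apply: (@le_trans _ _ (\sum_(g <- C)
    K ^+ 2 * (size Q)%:R * \sum_(q <- Q) F (emul g q) ^+ 2)).
  rewrite big_seq [leRHS]big_seq; apply: ler_sum => g /CG Gg.
  apply: (@le_trans _ _ ((K * \sum_(q <- Q) F (emul g q)) ^+ 2)).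
    have b := bound _ _ _ _ L g Gg; have := l1_ge0 _ _ (Phi u a B g).
    by move=> l0; rewrite ler_sqr ?nnegrE // (le_trans l0 b).
  by rewrite exprMn -mulrA ler_wpM2l ?sqr_ge0 // sqr_sum_le.
rewrite -mulr_sumr exchange_big /= -[leRHS]mulrA ler_wpM2l ?mulr_ge0 ?sqr_ge0 //.
rewrite (eq_big_seq (fun=> \sum_(g <- C) F g ^+ 2)) => [|q qQ].
  by rewrite big_const_seq count_predT iter_addr_0 mulr_natl.
apply: (sum_shift _ _ G H C Ggrp HG repC (fun g => F g ^+ 2)) => [|g t Gg Ht].
  exact: GQ.
by rewrite iF.
Qed.

(** * Direct sums and the lattice of translations *)

Section DirectSum.
Variables (R : realType) (d1 d2 : nat).
Implicit Types (A B : 'M[R]_d1) (s : Ed R d2).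

Lemma emul_dsum A B s s' :
  emul (dsum A s) (dsum B s') = dsum (A *m B) (emul s s').
Proof.
rewrite /emul /dsum /= mulmx_block mul_block_col add_col_mx.
by rewrite !(mulmx0, mul0mx, addr0, add0r).
Qed.

Lemma eone_dsum : eone R (d1 + d2) = dsum 1%:M (eone R d2).
Proof. by rewrite /eone /dsum /= scalar_mx_block col_mx0. Qed.

Lemma epow_dsum A s m : epow (dsum A s) m = dsum (iter m (mulmx A) 1%:M) (epow s m).
Proof. by elim: m => [|m IH] /=; rewrite ?eone_dsum // IH emul_dsum. Qed.

Lemma projS_dsum A s : projS (dsum A s) = s.
Proof. by case: s => B b; rewrite /projS /dsum /= block_mxKdr col_mxKd. Qed.

Lemma epow_translation m (b : 'cV[R]_d2) : epow (1%:M, b) m = (1%:M, b *+ m).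
Proof.
elim: m => //= m IH; by rewrite IH /emul /= !mul1mx mulrS.
Qed.

End DirectSum.

(* [T] need not be a group and need not commute, but its powers of order [m]
   form a group on which the projection to the translations is injective. *)
Lemma lattice_generators (R : realType) d1 d2 (S : set (Ed R d2))
    (G T : set (Ed R (d1 + d2))) m :
  space_group S ->
  (forall g, G g -> exists A s, [/\ is_orth A, S s & g = dsum A s]) ->
  T `<=` G ->
  (forall t t', T t -> T t' -> projS t = projS t' -> t = t') ->
  projS @` T = transl_subgroup S ->
  (0 < m)%N -> normal_sub (Tpow T m) G ->
  (forall h h', Tpow T m h -> Tpow T m h' -> emul h h' = emul h' h) /\
  exists (A : 'I_d2 -> 'M[R]_d1) (tau : 'M[R]_d2),
    [/\ tau \in unitmx, forall i, is_orth (A i) &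
        forall i, Tpow T m (dsum (A i) (1%:M, (row i tau)^T))].
Proof.
move=> [_ _ [b [Sb bfree]]] GS TG Tinj TS m0 [Hgrp HG _].
have [_ _ HM _] := Hgrp.
have powP s : T s -> exists A B c,
    [/\ s = dsum B (1%:M, c), epow s m = dsum A (1%:M, c *+ m) & is_orth A].
  move=> Ts; have : transl_subgroup S (projS s) by rewrite -TS; exists s.
  have [B [s' [_ _ e]]] := GS _ (TG _ Ts).
  rewrite [in projS s]e projS_dsum => -[_]; rewrite /is_translation.
  case: s' e => D c e /= D1; rewrite {}D1 in e.
  have [A [s'' [oA _ e2]]] : exists A s', [/\ is_orth A, S s' & epow s m = dsum A s'].
    by apply: GS; apply: HG; exists s.
  exists A, B, c; split=> //.
  have := congr1 projS e2; rewrite {1}e epow_dsum !projS_dsum epow_translation => e3.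
  by rewrite e2 e3.
split=> [h h' Hh Hh'|].
  (* Both products are [m]-th powers of elements of [T]. Their translation parts agree, [m] cancels
     there, and injectivity of [projS] on [T] identifies the two roots. *)
  have [s1 Ts1 e1] := HM _ _ Hh Hh'; have [s2 Ts2 e2] := HM _ _ Hh' Hh.
  have [s Ts hE] := Hh; have [s' Ts' h'E] := Hh'.
  have [A [B [c [_ pE _]]]] := powP _ Ts; have [A' [B' [c' [_ pE' _]]]] := powP _ Ts'.
  have [A1 [B1 [c1 [s1E pE1 _]]]] := powP _ Ts1; have [A2 [B2 [c2 [s2E pE2 _]]]] := powP _ Ts2.
  rewrite -e1 -e2; congr epow; apply: Tinj => //.
  rewrite s1E s2E !projS_dsum; congr pair.
  move: e1 e2; rewrite -hE -h'E pE pE' pE1 pE2 !emul_dsum.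
  move=> /(congr1 projS) + /(congr1 projS); rewrite !projS_dsum /emul /= !mul1mx.
  move=> [e1] [e2]; have : c1 *+ m = c2 *+ m by rewrite e1 e2 addrC.
  rewrite -!scaler_nat; apply: scalerI; by rewrite pnatr_eq0 -lt0n.
have /choice[s sP] : forall i, exists s, T s /\ projS s = (1%:M, b i).
  move=> i; have [s Ts e] : (projS @` T) (1%:M, b i) by rewrite TS; split.
  by exists s.
have /choice[A AP] : forall i, exists A, is_orth A /\ epow (s i) m = dsum A (1%:M, b i *+ m).
  move=> i; have [Ts e] := sP i; have [A [B [c [sE pE oA]]]] := powP _ Ts.
  by exists A; split=> //; move: e; rewrite pE sE projS_dsum => -[->].
exists A, (m%:R *: \matrix_(i < d2) (b i)^T); split=> [|i|i]; last 1 first.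
- exists (s i); first exact: (sP i).1.
  by rewrite (AP i).2 linearZ /= rowK linearZ /= trmxK scaler_nat.
- rewrite unitmxZ; first by rewrite -row_free_unit.
  by rewrite unitfE pnatr_eq0 -lt0n.
- exact: (AP i).1.
Qed.

(** * Difference operators recovering the lower right block *)

Section Gradient.
Variables (R : realType) (d1 d2 : nat) (G : set (Ed R (d1 + d2))).
Variables (x0 : 'cV[R]_(d1 + d2)) (Rs : {fset Ed R (d1 + d2)}).
Hypotheses (Ggrp : esubgroup G) (P2 : property2 G x0 Rs).

Definition poly_shifts (t : Ed R (d1 + d2)) (p : {poly R}) : seq (R * Ed R (d1 + d2)) :=
  [seq (p`_k, epow t k) | k <- iota 0 (size p)].

Lemma sum_poly_shifts (V : lmodType R) t p (f : Ed R (d1 + d2) -> V) :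
  \sum_(x <- poly_shifts t p) x.1 *: f x.2 = \sum_(k < size p) p`_k *: f (epow t k).
Proof. by rewrite big_map -[X in iota 0 X]subn0 -/(index_iota _ _) big_mkord. Qed.

(* [p] annihilates the rotation part of [t], whence the off-diagonal blocks of
   the local rotation disappear and only its lower right block survives. *)
Lemma controlled_gradient (A : 'M[R]_d1) (tau : 'cV[R]_d2) (p : {poly R}) :
  G (dsum A (1%:M, tau)) -> p.[1] = 0 -> p^`().[1] = 1 ->
  (forall v : 'cV_d1, \sum_(i < size p) p`_i *: iter i (mulmx A) v = 0) ->
  controlled R (d1 + d2) G x0 Rs d2 (fun u a B g =>
    \sum_(x <- poly_shifts (dsum A (1%:M, tau)) p) x.1 *: dsubmx (u (emul g x.2))
    - drsubmx (B g) *m tau).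
Proof.
set t := dsum _ _ => Gt p1 dp1 pA.
pose P : 'M[R]_(d2, d1 + d2) := row_mx 0 1%:M.
have PE v : P *m v = dsubmx v by rewrite -[v in LHS]vsubmxK mul_row_col mul0mx mul1mx add0r.
have C k : controlled R (d1 + d2) G x0 Rs d2 (fun u a B g => p`_k *:
    (P *m ((epow t k).1 *m u (emul g (epow t k))
           - rigid R (d1 + d2) x0 a B g (epow t k)))).
  apply/controlled_scale/controlled_mulmx/controlled_displacement => //.
  exact: epow_in.
have := controlled_sum _ _ _ _ _ Ggrp _ _ (index_enum 'I_(size p)) _ (fun k => C k).
move=> /controlled_ext; apply.
move=> u a B g Gg; rewrite (sum_poly_shifts _ t p (fun h => dsubmx (u (emul g h)))).
have powE k : epow t k = dsum (iter k (mulmx A) 1%:M) (1%:M, tau *+ k).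
  by rewrite /t epow_dsum epow_translation.
have iterE k v : iter k (mulmx A) v = iter k (mulmx A) 1%:M *m v :> 'cV_d1.
  by elim: k => [|k IH]; rewrite ?mul1mx //= IH mulmxA.
have p1E : \sum_(k < size p) p`_k = 0.
  by rewrite -[RHS]p1 horner_coef; apply: eq_bigr => k _; rewrite expr1n mulr1.
have dp1E : \sum_(k < size p) p`_k *+ k = 1.
  rewrite -[RHS]dp1 -[p in RHS]coefK poly_def raddf_sum horner_sum; apply: eq_bigr => k _ /=.
  by rewrite derivZ derivXn hornerZ hornerMn hornerXn expr1n mulr_natr.
pose x1 := usubmx x0.
(* Along powers of [t] the motion is a constant, a term in the [k]-th iterate of [A] on [x1], and a
   term linear in [k]. Weighted by the coefficients of [p], the first vanishes as [p.[1] = 0], the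
   second as [p] annihilates [A], and the third survives with factor 1, the derivative of [p] at
   1. *)
have rigidE k : P *m rigid R (d1 + d2) x0 a B g (epow t k) =
    dsubmx (a g) - dlsubmx (B g) *m x1 + dlsubmx (B g) *m iter k (mulmx A) x1
    + k%:R *: (drsubmx (B g) *m tau).
  rewrite PE /rigid powE /eact /= linearD /=.
  have -> : block_mx (iter k (mulmx A) 1%:M) 0 0 1%:M *m x0 + col_mx 0 (tau *+ k) - x0
     = col_mx (iter k (mulmx A) x1 - x1) (k%:R *: tau).
    rewrite -[x0]vsubmxK mul_block_col !mul0mx mul1mx addr0 add0r add_col_mx.
    by rewrite opp_col_mx add_col_mx addr0 -iterE addrAC subrr add0r scaler_nat.
  rewrite -[B g in LHS]submxK mul_block_col col_mxKd mulmxBr -scalemxAr.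
  by rewrite addrA; congr (_ + _); rewrite addrA addrAC.
transitivity (\sum_(k < size p) (p`_k *: dsubmx (u (emul g (epow t k)))
   - p`_k *: (P *m rigid R (d1 + d2) x0 a B g (epow t k)))).
  rewrite sumrB; congr (_ - _).
  under eq_bigr do rewrite rigidE !scalerDr scalemxAr.
  rewrite !big_split /= -!scaler_suml p1E !scale0r addr0 -mulmx_sumr pA mulmx0.
  rewrite !add0r; under eq_bigr do rewrite scalerA mulr_natr.
  by rewrite -scaler_suml dp1E scale1r.
apply: eq_bigr => k _; rewrite -scalerBr mulmxBr; congr (_ *: (_ - _)).
rewrite PE powE /= -[X in _ *m X]vsubmxK mul_block_col !mul0mx mul1mx.
by rewrite col_mxKd add0r.
Qed.

End Gradient.

(** * Distance to infinitesimal rigid motions *)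

Section Distance.
Variables (R : realType) (n : nat) (Sk : 'M[R]_n -> Prop) (x0 : 'cV[R]_n).
Variable Rs : {fset Ed R n}.
Hypothesis Sk0 : Sk 0.
Implicit Type v w : Ed R n -> 'cV[R]_n.

Let U := Uiso_gen Sk x0 Rs.
Let dists v := [set normRs Rs (fun h => v h - w h) | w in U].

Lemma Uiso_gen0 : U (fun=> 0).
Proof. by exists 0, 0; split=> // g _; rewrite mulmx0 mul0mx addr0. Qed.

Lemma has_inf_dists v : has_inf (dists v).
Proof.
split; first by exists (normRs Rs (fun h => v h - 0)), (fun=> 0) => //; apply: Uiso_gen0.
by exists 0 => _ [w _ <-]; apply: normRs_ge0.
Qed.

Lemma distRs_ge0 v : 0 <= distRs Rs v U.
Proof. by apply: lb_le_inf; [case: (has_inf_dists v)|move=> _ [w _ <-]; apply: normRs_ge0]. Qed.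

Lemma distRs_le v w : U w -> distRs Rs v U <= normRs Rs (fun h => v h - w h).
Proof. by move=> Uw; apply: ge_inf; [case: (has_inf_dists v)|exists w]. Qed.

(** The slack [delta] comes from the infimum, [n] from comparing norms, and the sum of matrix norms
    from multiplying by [h.1]. *)
Lemma near_optimal v (delta : R) : 0 < delta ->
  exists a B, Sk B /\ forall h, h \in Rs ->
    l1 (h.1 *m v h - (a + B *m (eact h x0 - x0))) <=
    (\sum_(h <- Rs) mx_l1 h.1) * n%:R * (distRs Rs v U + delta).
Proof.
move=> d0; have [_ [w [a [B [SkB wE]]] <-] lt] := inf_adherent d0 (has_inf_dists v).
exists a, B; split=> // h hRs; rewrite -wE // -mulmxBr.
apply: le_trans (l1_mulmx _ _ _ _ _) _; rewrite -mulrA.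
apply: ler_pM; rewrite ?mx_l1_ge0 ?l1_ge0 //.
  by rewrite (big_fsetD1 h) //= lerDl sumr_ge0 // => *; apply: mx_l1_ge0.
apply: (le_trans (l1_le_normRs _ _ _ (fun h => v h - w h) _ hRs)).
by rewrite ler_wpM2l // ltW.
Qed.

Lemma distRs_ext v v' : (forall h, h \in Rs -> v h = v' h) ->
  distRs Rs v U = distRs Rs v' U.
Proof.
move=> e; congr inf; apply/eq_imagel => w _; congr Num.sqrt.
by apply: eq_big_seq => h /e ->.
Qed.

End Distance.

(** * The Korn inequality for squared distances *)

Section KornInequality.
Variables (R : realType) (d1 d2 : nat) (G H0 : set (Ed R (d1 + d2))).
Variables (x0 : 'cV[R]_(d1 + d2)) (Rs : {fset Ed R (d1 + d2)}).
Variables (A : 'I_d2 -> 'M[R]_d1) (tau : 'M[R]_d2).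
Hypotheses (Ggrp : esubgroup G) (P2 : property2 G x0 Rs).
Hypotheses (H0grp : esubgroup H0) (H0G : H0 `<=` G).
Hypothesis H0com : forall h h', H0 h -> H0 h' -> emul h h' = emul h' h.
Hypotheses (tauU : tau \in unitmx) (orthA : forall i, is_orth (A i)).
Let t i : Ed R (d1 + d2) := dsum (A i) (1%:M, (row i tau)^T).
Hypothesis H0t : forall i, H0 (t i).

(** The matrix of the scalars psi_ij. The congruence preserves skewness and, [tau] being invertible,
    loses nothing of the lower right block. *)
Let skew_part (B : 'M[R]_(d1 + d2)) : 'M[R]_d2 := tau *m drsubmx B *m tau^T.

Lemma skew_blocks (B : 'M[R]_(d1 + d2)) : Defs.skew B ->
  [/\ (ulsubmx B)^T = - ulsubmx B, (dlsubmx B)^T = - ursubmx B,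
      (ursubmx B)^T = - dlsubmx B & (drsubmx B)^T = - drsubmx B].
Proof.
by rewrite /Defs.skew -{1 2}[B]submxK tr_block_mx opp_block_mx => /eq_block_mx[].
Qed.

Lemma skew0_0 : skew0 (0 : 'M[R]_(d1 + d2)).
Proof. by split; [rewrite /Defs.skew trmx0 oppr0|apply/matrixP => i j; rewrite !mxE]. Qed.

Lemma skew_part_skew (B : 'M[R]_(d1 + d2)) :
  Defs.skew B -> forall i j, skew_part B i j = - skew_part B j i.
Proof.
move=> skB i j; have : (skew_part B)^T = - skew_part B.
  rewrite /skew_part !trmx_mul trmxK mulmxA.
  have [_ _ _ ->] := skew_blocks _ skB.
  by rewrite mulmxN mulNmx.
by move=> /matrixP/(_ j i); rewrite !mxE.
Qed.

Lemma skew_part_bound (y : 'cV[R]_d2) : exists2 K, 0 <= K &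
  forall B, l1 (drsubmx B *m y) <= K * mx_l1 (skew_part B).
Proof.
exists (mx_l1 (invmx tau) * l1 (invmx tau^T *m y)) => [|B].
  by rewrite mulr_ge0 ?mx_l1_ge0 ?l1_ge0.
have -> : drsubmx B *m y = invmx tau *m (skew_part B *m (invmx tau^T *m y)).
  rewrite /skew_part -!mulmxA (mulmxA tau^T) mulmxV ?unitmx_tr // mul1mx.
  by rewrite (mulmxA (invmx tau)) mulVmx // mul1mx.
apply: le_trans (l1_mulmx _ _ _ _ _) _; rewrite -mulrA ler_wpM2l ?mx_l1_ge0 //.
by rewrite mulrC l1_mulmx.
Qed.

(** Coordinate [k] of [err l] is the error of [L_l] on [phi k] against psi_kl, so one controlled
    vector serves all [k]. The shifts lie in the commutative [H0], as [discrete_korn] requires. *)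
Lemma skew_field_l2 : exists2 K, 0 <= K &
  forall H C, normal_sub H G -> representatives G H C ->
  forall u a B F, locally_rigid R _ G x0 Rs u a B F -> right_invariant R _ G H F ->
  periodic G H u -> (forall g, Defs.skew (B g)) ->
  forall i j, \sum_(g <- C) skew_part (B g) i j ^+ 2 <= K * \sum_(g <- C) F g ^+ 2.
Proof.
have /choice[p pP] : forall i, exists p : {poly R}, [/\ p.[1] = 0, p^`().[1] = 1 &
    forall v : 'cV_d1, \sum_(k < size p) p`_k *: iter k (mulmx (A i)) v = 0].
  by move=> i; apply: orthogonal_annihilator.
pose err j (u a : Ed R (d1 + d2) -> 'cV[R]_(d1 + d2))
    (B : Ed R (d1 + d2) -> 'M[R]_(d1 + d2)) g : 'cV_d2 := tau *m
  (\sum_(x <- poly_shifts R d1 d2 (t j) (p j)) x.1 *: dsubmx (u (emul g x.2))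
   - drsubmx (B g) *m (row j tau)^T).
have ctl j : controlled R _ G x0 Rs d2 (err j).
  have [p1 dp1 pA] := pP j.
  apply: controlled_mulmx; apply: controlled_gradient => //; exact/H0G/H0t.
have /choice[K KP] : forall j, exists K, 0 <= K /\ forall H C, normal_sub H G ->
    representatives G H C -> forall u a B F, locally_rigid R _ G x0 Rs u a B F ->
    right_invariant R _ G H F ->
    \sum_(g <- C) l1 (err j u a B g) ^+ 2 <= K * \sum_(g <- C) F g ^+ 2.
  move=> j; have [K K0 H] := controlled_l2 _ _ _ _ _ _ _ Ggrp (ctl j).
  by exists K.
have sK0 : 0 <= \sum_j K j by apply: sumr_ge0 => j _; apply: (KP j).1.
exists (8 * \sum_j K j) => [|H C HG repC u a B F L iF per skB i j]; first exact: mulr_ge0.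
pose phi k (g : Ed R (d1 + d2)) := (tau *m dsubmx (u g)) k 0.
pose r k := poly_shifts R d1 d2 (t k) (p k).
have rH0 k x : x \in r k -> H0 x.2.
  by case/mapP => l _ -> /=; apply: epow_in.
rewrite -mulrA.
apply: (discrete_korn _ _ _ _ _ Ggrp HG repC d2 r phi (fun k l g => skew_part (B g) k l)).
- by move=> k x /rH0/H0G.
- by move=> k l x y /rH0 ? /rH0 ?; apply: H0com.
- by move=> k g h Gg Hh; rewrite /phi per.
- by move=> k l g; apply: skew_part_skew.
move=> k l; apply: (@le_trans _ _ (\sum_(g <- C) l1 (err l u a B g) ^+ 2)); last first.
  apply: le_trans ((KP l).2 _ _ HG repC u a B F L iF) _.
  rewrite ler_wpM2r ?sumr_ge0 // => [? _|]; first exact: sqr_ge0.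
  by rewrite (bigD1 l) //= lerDl sumr_ge0 // => m _; apply: (KP m).1.
apply: ler_sum => g _.
suff -> : shift_comb R _ (r l) (phi k) g - skew_part (B g) k l = err l u a B g k 0.
  by rewrite -real_normK ?num_real // ler_sqr ?nnegrE ?l1_ge0 // coord_l1.
rewrite /err mulmxBr [RHS]mxE [X in _ = _ + X]mxE; congr (_ - _).
  rewrite mulmx_sumr summxE; apply: eq_bigr => x _.
  by rewrite -scalemxAr mxE.
rewrite /skew_part -!mulmxA mulmxA mulmxA !mxE; apply: eq_bigr => m _.
by rewrite !mxE.
Qed.

(** Deleting the lower right block of [B g] makes the fitted motion admissible for [Uiso0]. The
    price is that block applied to finitely many vectors, which [skew_part] bounds. *)
Lemma dist_skew0_le : exists2 K, 0 <= K & forall g u a B F,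
  G g -> locally_rigid R _ G x0 Rs u a B F -> Defs.skew (B g) ->
  distRs Rs (fun h => u (emul g h)) (Uiso0 x0 Rs)
    <= K * (F g + mx_l1 (skew_part (B g))).
Proof.
have RsG : [set` Rs] `<=` G by case: P2.
have orth h : h \in Rs -> h.1^T *m h.1 = 1%:M.
  by move=> /RsG; case: Ggrp => + _ _ _ Gh => /(_ _ Gh); apply: mulmx1C.
have /choice[K KP] : forall h : Ed R (d1 + d2), exists K, 0 <= K /\ forall B,
    l1 (drsubmx B *m dsubmx (eact h x0 - x0)) <= K * mx_l1 (skew_part B).
  by move=> h; have [K K0 H] := skew_part_bound (dsubmx (eact h x0 - x0)); exists K.
exists (\sum_(h <- Rs) mx_l1 h.1^T * (1 + K h)) => [|g u a B F Gg L skB].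
  apply: sumr_ge0 => h _; rewrite mulr_ge0 ?mx_l1_ge0 // addr_ge0 //.
  exact: (KP h).1.
pose B0 := block_mx (ulsubmx (B g)) (ursubmx (B g)) (dlsubmx (B g)) 0.
have sk0 : skew0 B0.
  rewrite /skew0 block_mxKdr; split=> //; rewrite /Defs.skew /B0 tr_block_mx.
  by have [-> -> -> _] := skew_blocks _ skB; rewrite opp_block_mx trmx0 oppr0.
pose w h := h.1^T *m (a g + B0 *m (eact h x0 - x0)).
have Uw : Uiso0 x0 Rs w.
  exists (a g), B0; split=> // h hRs; rewrite /w mulmxA.
  by rewrite /Defs.rot (mulmx1C (orth h hRs)) mul1mx.
apply: le_trans (distRs_le _ _ skew0 x0 Rs _ _ _ Uw) _.
  exact: skew0_0.
apply: le_trans (normRs_le_l1 _ _ _ _) _.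
rewrite mulr_suml big_seq [leRHS]big_seq; apply: ler_sum => h hRs.
have [F0 /(_ h hRs) near] := L g Gg.
have m0 := mx_l1_ge0 _ _ _ (skew_part (B g)).
have -> : u (emul g h) - w h = h.1^T *m ((h.1 *m u (emul g h) - rigid R _ x0 a B g h)
    + col_mx (0 : 'cV_d1) (drsubmx (B g) *m dsubmx (eact h x0 - x0))).
  rewrite /w -[in LHS](mul1mx (u _)) -(orth h hRs) -mulmxA -mulmxBr; congr (_ *m _).
  rewrite /rigid; set y := eact h x0 - x0; rewrite -[RHS]addrA; congr (_ + _).
  rewrite !opprD -addrA; congr (_ + _).
  rewrite -[B g]submxK -[y]vsubmxK !mul_block_col mul0mx addr0.
  rewrite block_mxKdr col_mxKd !opp_col_mx add_col_mx addr0; congr col_mx.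
  by rewrite opprD subrK.
apply: le_trans (l1_mulmx _ _ _ _ _) _; rewrite -mulrA ler_wpM2l ?mx_l1_ge0 //.
apply: le_trans (l1D _ _ _ _) _.
rewrite l1_col0mx.
have [K0 /(_ (B g)) Kb] := KP h.
nra.
Qed.

Lemma korn_inequality : exists2 K, 0 <= K & forall H C u,
  normal_sub H G -> representatives G H C -> periodic G H u ->
  \sum_(g <- C) distRs Rs (fun h => u (emul g h)) (Uiso0 x0 Rs) ^+ 2 <=
  K * \sum_(g <- C) distRs Rs (fun h => u (emul g h)) (Uiso x0 Rs) ^+ 2.
Proof.
have [K1 K10 K1P] := skew_field_l2; have [K2 K20 K2P] := dist_skew0_le.
have RsG : [set` Rs] `<=` G by case: P2.
have [_ _ GM _] := Ggrp.
pose c : R := (\sum_(h <- Rs) mx_l1 h.1) * (d1 + d2)%:R.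
have c0 : 0 <= c by rewrite mulr_ge0 // sumr_ge0 // => *; apply: mx_l1_ge0.
pose N : R := (size (index_enum ('I_d2 * 'I_d2)%type))%:R.
(* [K2] is the cost of deleting the block, each 2 comes from splitting a square, one [N] is
   Cauchy-Schwarz over the matrix entries, the other their number, and [c] turns distances into
   defect bounds. *)
pose M := K2 ^+ 2 * (2 + 2 * (N * (N * K1))) * c ^+ 2.
have N0 : 0 <= N by [].
have M0 : 0 <= M.
  have NK : 0 <= N * (N * K1) by rewrite !mulr_ge0.
  by apply: mulr_ge0 (sqr_ge0 _); apply: mulr_ge0 (sqr_ge0 _) _; lra.
exists (2 * M) => [|H C u HG repC per]; first exact: mulr_ge0.
have [CG _ _] := repC.
set dist := fun g => distRs Rs (fun h => u (emul g h)) (Uiso x0 Rs).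
have skew_0 : Defs.skew (0 : 'M[R]_(d1 + d2)) by case: skew0_0.
have dist0 g : 0 <= dist g by apply: distRs_ge0.
have idist : right_invariant R _ G H dist.
  move=> g s Gg Hs; apply: distRs_ext => h /RsG Gh.
  have [s' Hs' e] := emul_normal _ _ _ _ Ggrp HG _ _ Gh Hs.
  by rewrite emulA e -emulA per //; apply: GM.
suff approx delta : 0 < delta ->
    \sum_(g <- C) distRs Rs (fun h => u (emul g h)) (Uiso0 x0 Rs) ^+ 2 <=
    M * \sum_(g <- C) (dist g + delta) ^+ 2.
  apply/ler_addgt0Pr => e e0.
  (* The slack may depend on [C]. Splitting it off costs the factor 2 in [2 * M]; with square
     [e / m] it contributes [(m - 1) * (e / m)], at most [e]. *)
  pose m : R := 2 * M * (size C)%:R + 1.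
  have m0 : 0 < m.
    by rewrite /m ltr_pwDr // mulr_ge0 // mulr_ge0.
  have d0 : 0 < Num.sqrt (e / m) by rewrite sqrtr_gt0 divr_gt0.
  apply: le_trans (approx _ d0) _.
  have : Num.sqrt (e / m) ^+ 2 = e / m by rewrite sqr_sqrtr // ltW // divr_gt0.
  move: (Num.sqrt _) => s s2.
  have : \sum_(g <- C) (dist g + s) ^+ 2 <= \sum_(g <- C) (2 * dist g ^+ 2 + 2 * (e / m)).
    by apply: ler_sum => g _; rewrite -s2; have := sqr_ge0 (dist g - s); nra.
  move=> /(ler_wpM2l M0) le1; apply: (le_trans le1).
  rewrite big_split /= -mulr_sumr big_const_seq count_predT iter_addr_0.
  rewrite mulrDr mulrCA mulrA lerD2l -[_ *+ size _]mulr_natr.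
  have -> : M * (2 * (e / m) * (size C)%:R) = (m - 1) * (e / m) by rewrite /m; ring.
  by rewrite mulrBl mulrCA divff ?gt_eqF // mulr1 mul1r gerBl divr_ge0 // ltW.
move=> delta0.
have /choice[ab abP] : forall g, exists ab : 'cV[R]_(d1 + d2) * 'M[R]_(d1 + d2),
    Defs.skew ab.2 /\ forall h, h \in Rs ->
    l1 (h.1 *m u (emul g h) - (ab.1 + ab.2 *m (eact h x0 - x0))) <= c * (dist g + delta).
  move=> g; have [a [B [skB near]]] :=
    near_optimal _ _ _ x0 Rs skew_0 (fun h => u (emul g h)) delta delta0.
  by exists (a, B).
pose a g := (ab g).1; pose B g := (ab g).2; pose F g := c * (dist g + delta).
have F0 g : 0 <= F g by rewrite mulr_ge0 // addr_ge0 // ltW.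
have L : locally_rigid R _ G x0 Rs u a B F.
  by move=> g Gg; split=> // h hRs; apply: (abP g).2.
have iF : right_invariant R _ G H F by move=> g s Gg Hs; rewrite /F idist.
have skB g : Defs.skew (B g) by apply: (abP g).1.
have psi2 := K1P H C HG repC u a B F L iF per skB.
have step : \sum_(g <- C) distRs Rs (fun h => u (emul g h)) (Uiso0 x0 Rs) ^+ 2 <=
    \sum_(g <- C) (K2 ^+ 2 * (2 * F g ^+ 2 +
       2 * (N * \sum_i skew_part (B g) i.1 i.2 ^+ 2))).
  rewrite big_seq [leRHS]big_seq; apply: ler_sum => g /CG Gg.
  have le1 := K2P g u a B F Gg L (skB g).
  have ge0 : 0 <= distRs Rs (fun h => u (emul g h)) (Uiso0 x0 Rs).
    by apply: distRs_ge0; apply: skew0_0.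
  have m0 := mx_l1_ge0 _ _ _ (skew_part (B g)).
  apply: (@le_trans _ _ ((K2 * (F g + mx_l1 (skew_part (B g)))) ^+ 2)).
    by rewrite ler_sqr ?nnegrE // (le_trans ge0 le1).
  rewrite exprMn ler_wpM2l ?sqr_ge0 //.
  apply: (@le_trans _ _ (2 * F g ^+ 2 + 2 * mx_l1 (skew_part (B g)) ^+ 2)).
    by have := sqr_ge0 (F g - mx_l1 (skew_part (B g))); nra.
  rewrite lerD2l ler_wpM2l // /mx_l1 pair_bigA.
  apply: le_trans (sqr_sum_le _ _ _ _) _; rewrite ler_wpM2l //.
  by apply: ler_sum => i _; rewrite real_normK ?num_real.
apply: (le_trans step); rewrite -mulr_sumr big_split /= -!mulr_sumr exchange_big /=.
have -> : M * \sum_(g <- C) (dist g + delta) ^+ 2 =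
    K2 ^+ 2 * (2 * \sum_(g <- C) F g ^+ 2 + 2 * (N * (N * (K1 * \sum_(g <- C) F g ^+ 2)))).
  have -> : \sum_(g <- C) F g ^+ 2 = c ^+ 2 * \sum_(g <- C) (dist g + delta) ^+ 2.
    by rewrite mulr_sumr; apply: eq_bigr => g _; rewrite exprMn.
  by rewrite /M; ring.
rewrite ler_wpM2l ?sqr_ge0 // lerD2l !ler_wpM2l //.
apply: le_trans (ler_sum _ (fun i _ => psi2 i.1 i.2)) _.
by rewrite big_const_seq count_predT iter_addr_0 mulr_natl.
Qed.

End KornInequality.

(** * Equivalence of the seminorms *)

Lemma distRs_anti (R : realType) n (Sk Sk' : 'M[R]_n -> Prop) x0 Rs v :
  Sk 0 -> (forall B, Sk B -> Sk' B) ->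
  distRs Rs v (Uiso_gen Sk' x0 Rs) <= distRs Rs v (Uiso_gen Sk x0 Rs).
Proof.
move=> Sk0 sub; have Sk'0 := sub _ Sk0.
apply: lb_le_inf; first by case: (has_inf_dists _ _ Sk x0 Rs Sk0 v).
move=> _ [w [a [B [SkB wE]]] <-]; apply: distRs_le Sk'0 _ _ _.
by exists a, B; split=> //; apply: sub.
Qed.

Theorem theorem3p21 (R : realType) (d1 d2 : nat)
  (S : set (Ed R d2)) (G T : set (Ed R (d1 + d2)))
  (m0 : nat) (CN : nat -> {fset Ed R (d1 + d2)})
  (x0 : 'cV[R]_(d1 + d2)) (daff : nat) (Rs : {fset Ed R (d1 + d2)}) :
  (* S is a space group in E(d2) *)
  space_group S ->
  (* G is a ediscrete esubgroup of E(d1+d2) contained in O(d1) (+) S ... *)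
  esubgroup G -> ediscrete G ->
  (forall g, G g -> exists A s, [/\ is_orth A, S s & g = dsum A s]) ->
  (* ... and projecting onto S *)
  (forall s, S s -> exists A, is_orth A /\ G (dsum A s)) ->
  (* T is a subset of G mapped bijectively onto T_S *)
  T `<=` G ->
  (forall t t', T t -> T t' -> projS t = projS t' -> t = t') ->
  projS @` T = transl_subgroup S ->
  (* T^N is normal in G iff N is in M = m0 N *)
  (0 < m0)%N ->
  (forall N, (0 < N)%N -> (normal_sub (Tpow T N) G <-> (m0 %| N)%N)) ->
  (* C_N are fixed sets of representatives of G / T^N, N in M *)
  (forall N, (0 < N)%N -> (m0 %| N)%N ->
     representatives G (Tpow T N) (CN N)) ->
  (* x0 : g |-> g.x0 injective on G *)
  (forall g h, G g -> G h -> eact g x0 = eact h x0 -> g = h) ->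
  (* d_aff = dim aff(G.x0), and the normalisation of coordinates *)
  aff_dim (eorbit G x0) daff ->
  (forall g, G g -> forall i : 'I_(d1 + d2),
     (i < d1 + d2 - daff)%N -> eact g x0 i 0 = 0) ->
  (forall g, G g -> forall (x : 'cV[R]_(d1 + d2)) (i : 'I_(d1 + d2)),
     (i < d1 + d2 - daff)%N -> eact g x i 0 = x i 0) ->
  (* Rs has Property 2 *)
  property2 G x0 Rs ->
  (* the seminorms are equivalent on U_per *)
  exists2 c : R, 0 < c & exists2 C : R, 0 < C &
    forall N, (0 < N)%N -> (m0 %| N)%N ->
    forall u : Ed R (d1 + d2) -> 'cV[R]_(d1 + d2),
      periodic G (Tpow T N) u ->
      c * seminormR0 x0 Rs (CN N) u <= seminormR x0 Rs (CN N) u /\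
      seminormR x0 Rs (CN N) u <= C * seminormR0 x0 Rs (CN N) u.
Proof.
move=> Sspace Ggrp _ GS _ TG Tinj TS m0_gt0 normT repT _ _ _ _ P2.
(* The reference lattice is [Tpow T m0] for every [N], which makes the constants independent of the
   period. *)
have H0G := (normT m0 m0_gt0).2 (dvdnn m0).
have [H0com [A [tau [tauU oA H0t]]]] :=
  lattice_generators _ _ _ _ _ _ _ Sspace GS TG Tinj TS m0_gt0 H0G.
have [H0grp H0sub _] := H0G.
have [K K0 korn] :=
  korn_inequality _ _ _ _ _ _ _ _ _ Ggrp P2 H0grp H0sub H0com tauU oA H0t.
have K1 : 0 < Num.sqrt (K + 1) by rewrite sqrtr_gt0 ltr_wpDl.
exists (Num.sqrt (K + 1))^-1; first by rewrite invr_gt0.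
(* The constant 1 suffices as [Uiso0] is contained in [Uiso]. *)
exists 1 => [//|N N0 m0N u per]; have HN := (normT N N0).2 m0N.
have a0 : 0 <= (#|` CN N|%:R : R)^-1 by rewrite invr_ge0.
have sqr_sum_ge0 U : 0 <= \sum_(g <- CN N) distRs Rs (fun h => u (emul g h)) U ^+ 2.
  by apply: sumr_ge0 => g _; apply: sqr_ge0.
split.
  rewrite ler_pdivrMl // /seminormR0 /seminormR /seminorm_gen -sqrtrM ?addr_ge0 //.
  rewrite ler_wsqrtr // mulrCA ler_wpM2l //.
  apply: le_trans (korn _ _ u HN (repT N N0 m0N) per) _.
  by rewrite ler_wpM2r // lerDl.
rewrite mul1r /seminormR0 /seminormR /seminorm_gen ler_wsqrtr // ler_wpM2l //.
apply: ler_sum => g _; rewrite ler_sqr ?nnegrE; first last.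
- by apply: distRs_ge0; apply: skew0_0.
- by apply: distRs_ge0; case: (skew0_0 R d1 d2).
by apply: distRs_anti => [|B []]; first exact: skew0_0.
Qed.
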